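(* Let $H$ be a complex Hilbert space with $\dim H\geq 3$ and let $T\in B(H)$ be such that $T^3=0$. If $\operatorname{Re}(T^2)\geq 0$ or $\operatorname{Im}(T^2)\geq 0$, then $T^2=0$.
   Context: $H$ is a complex Hilbert space (possibly infinite-dimensional) and $B(H)$ is the algebra of bounded linear operators from $H$ into itself. For $S\in B(H)$, $\operatorname{Re} S=(S+S^* )/2$ and $\operatorname{Im} S=(S-S^* )/(2\mathrm{i})$ (both self-adjoint operators), where $S^*$ is the adjoint of $S$; $S\geq 0$ (positive) means $\langle Sx,x\rangle\geq 0$ for all $x\in H$. *)

(* Defs.v *)
From HB Require Import structures.
From mathcomp Require Import all_boot all_order all_algebra.
From mathcomp Require Import sesquilinear complex.
From mathcomp Require Import all_classical all_reals all_analysis.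

Set Implicit Arguments.
Unset Strict Implicit.
Unset Printing Implicit Defensive.

Import Order.TTheory GRing.Theory Num.Theory.
Import numFieldNormedType.Exports.

Local Open Scope ring_scope.
Local Open Scope complex_scope.

(* A complex Hilbert space is a complete normed module over R[i] whose norm
   comes from an inner product.  The inner product is linear in its first
   argument and conjugate-linear in its second one. *)
HB.mixin Record isHilbert (R : realType) H & CompleteNormedModule R[i] H := {
  inner : {dot H for (@Num.conj R[i])};
  inner_norm : forall x : H, inner x x = `|x| ^+ 2
}.

#[short(type="hilbertType")]
HB.structure Definition Hilbert (R : realType) :=
  {H of isHilbert R H & CompleteNormedModule R[i] H}.

Arguments inner {R s}.

Section HilbertOperators.
Context {R : realType} {H : hilbertType R}.
Implicit Types S : {linear H -> H}.

Definition bounded_operator S : Prop :=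
  exists M : R, forall x, `|S x| <= M%:C * `|x|.

Definition is_adjoint S S' : Prop :=
  forall x y, inner (S x) y = inner x (S' y).

(* By the Riesz representation theorem, every bounded operator has exactly one
   bounded adjoint, which [get] selects; on unbounded linear maps the value is
   irrelevant. *)
Definition adjoint S : {linear H -> H} :=
  get (fun S' : {linear H -> H} => bounded_operator S' /\ is_adjoint S S').

Definition ReOp S : {linear H -> H} := 2^-1 \*: (S \+ adjoint S).
Definition ImOp S : {linear H -> H} := (2 * 'i)^-1 \*: (S \- adjoint S).

(* In R[i], 0 <= z means that z is real and nonnegative. *)
Definition positive_operator S : Prop := forall x, 0 <= inner (S x) x.

End HilbertOperators.

(* The dimension of V, possibly infinite, is at least n: there is a linearly
   independent family of n vectors. *)
Definition dim_ge {K : nzRingType} (V : lmodType K) (n : nat) : Prop :=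
  exists e : 'I_n -> V, forall c : 'I_n -> K,
    \sum_(i < n) c i *: e i = 0 -> forall i, c i = 0.

(* Main.v *)
From HB Require Import structures.
Require Import Defs.
From mathcomp Require Import all_boot all_order all_algebra.
From mathcomp Require Import sesquilinear complex ring.
From mathcomp Require Import all_classical all_reals all_analysis.

(** Put S = T^2, so that S^2 = T^4 = 0.  Suppose that Re(a <Sx, x>) is
    nonnegative for every x, where a = 1 when Re S is positive and a = -i when
    Im S is positive.  Evaluating this form at x + c Sx with c a scalar, the
    equality S(x + c Sx) = Sx leaves
      Re(a <Sx, x>) + Re(a (conj c) |Sx|^2) >= 0,
    which is an affine function of c bounded below on the whole complex plane.
    Its slope a |Sx|^2 therefore vanishes, and Sx = 0
    ([square_zero_positive_real_part]).

    What remains is that the hypotheses do give information on Re(a <Sx, x>):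
    [ReOp] and [ImOp] involve the adjoint, and for this the Riesz
    representation theorem is needed.  A bounded functional f is represented
    by a vector that minimizes |y|^2 - 2 Re f(y).  Perturbing a point y at
    which this functional is within e^2 of its infimum into y + c x gives a
    quadratic inequality in c whose discriminant says that
    |<x, y> - f x| <= e |x|, i.e. y represents f up to e in operator norm
    ([approximate_representer]).  Applied to x = y - y', this bound shows that
    two approximate representers are close, so that a sequence of them with
    errors tending to 0 is Cauchy, and its limit represents f exactly
    ([riesz]).

    One lemma on quadratic functions, [quadratic_ge0_discriminant], serves
    three times: for the Cauchy-Schwarz inequality, for the approximate
    representers, and, in the case where the quadratic term is zero, for the
    operator S above. *)

Import Order.TTheory GRing.Theory Num.Theory.
Local Open Scope complex_scope.
Local Open Scope ring_scope.

(** The complex form of: a quadratic polynomial that is nonnegative has a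
    nonpositive discriminant.  The parameter c is restricted to the ray of
    direction - d^*, along which the linear term is the most negative; it
    remains to choose a point of this ray: the minimum of the parabola when
    0 < a, and a point beyond the zero of the affine function when a = 0. *)
Lemma quadratic_ge0_discriminant {C : numClosedFieldType} (a b d : C) :
    0 <= a ->
    (forall c, 0 <= `|c| ^+ 2 * a + (c * d + (c * d)^*) + b) ->
  `|d| ^+ 2 <= a * b.
Proof.
move=> a0 q.
have b0 : 0 <= b.
  by have := q 0; rewrite normr0 expr0n mul0r mul0r conjC0 !add0r.
have D0 : 0 <= `|d| ^+ 2 by rewrite exprn_ge0.
have qt t : 0 <= t -> 2 * (t * `|d| ^+ 2) <= t ^+ 2 * `|d| ^+ 2 * a + b.
  move=> t0; have := q (- (t * d^*)).
  rewrite normrN normrM norm_conjC (ger0_norm t0) exprMn.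
  have -> : - (t * d^*) * d = - (t * `|d| ^+ 2).
    by rewrite normCK mulNr -mulrA (mulrC d).
  rewrite rmorphN /= geC0_conj ?mulr_ge0// -opprD addrAC subr_ge0.
  by rewrite -mulr2n mulr_natl.
have [a_eq0|a_neq0] := eqVneq a 0; last first.
  have apos : 0 < a by rewrite lt0r a_neq0.
  have := qt a^-1; rewrite invr_ge0 a0 => /(_ isT).
  rewrite expr2 (mulrAC _ _ a) divfK// mulr_natl mulr2n.
  by rewrite lerD2l ler_pdivrMl.
rewrite a_eq0 mul0r; have [->|D_neq0] := eqVneq (`|d| ^+ 2) 0.
  exact: lexx.
have Dpos : 0 < `|d| ^+ 2 by rewrite lt0r D_neq0.
have := qt ((b + 1) / `|d| ^+ 2).
rewrite divr_ge0 ?addr_ge0 ?ler01// => /(_ isT).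
rewrite a_eq0 mulr0 add0r divfK// => h.
have : 2 * (b + 1) - b <= 0 by rewrite subr_le0.
have -> : 2 * (b + 1) - b = b + 2 by ring.
by rewrite lt_geF ?ltr_wpDl.
Qed.

(** * Inner product and the Cauchy-Schwarz inequality *)

Section InnerProduct.
Context {R : realType} {H : hilbertType R}.
Local Notation C := R[i].
Implicit Types (x y z : H) (c : C) (S : {linear H -> H}).
Import numFieldNormedType.Exports.

Lemma inner_linearl z : scalar (inner^~ z : H -> C).
Proof. by move=> c x y; rewrite linearDl linearZl_LR. Qed.

Lemma inner_conj x y : inner y x = (inner x y)^*.
Proof. by rewrite hermC expr0 mul1r. Qed.

Lemma inner_eq x y : (forall z, inner z x = inner z y) -> x = y.
Proof.
move=> xy; apply/eqP; rewrite -subr_eq0 -(dnorm_eq0 inner).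
by rewrite linearBr /= xy subrr.
Qed.

Lemma inner_normD x y c :
  `|y + c *: x| ^+ 2 =
  `|c| ^+ 2 * `|x| ^+ 2 + (c * inner x y + (c * inner x y)^*) + `|y| ^+ 2.
Proof.
rewrite -!inner_norm addrC dnormD dnormZ /= linearZl_LR /=.
by rewrite addrAC.
Qed.

Lemma inner_CauchySchwarz x y : `|inner x y| <= `|x| * `|y|.
Proof.
rewrite -(@ler_pXn2r _ 2)// ?nnegrE ?mulr_ge0// exprMn.
apply: quadratic_ge0_discriminant => [|c]; first exact: exprn_ge0.
by rewrite -inner_normD exprn_ge0.
Qed.

(** * The Riesz representation theorem *)

Section Riesz.
Context (f : H -> C) (M : R).
Hypotheses (lin_f : scalar f) (f_le : forall x, `|f x| <= M%:C * `|x|).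

(** Up to the constant |u|^2, this is |x - u|^2 for u the representing vector,
    which is why its minimizers represent f. *)
Let J x : C := `|x| ^+ 2 - (f x + (f x)^*).

Let J_real x : (complex.Re (J x))%:C = J x.
Proof.
apply: RRe_real.
by rewrite rpredB ?rpredX ?normr_real// CrealE rmorphD /= conjCK addrC.
Qed.

(* Completing the square in |x|, since Re f(x) <= M |x|. *)
Let J_ge x : - (M ^+ 2)%:C <= J x.
Proof.
have : f x + (f x)^* <= 2 * (M%:C * `|x|).
  apply: le_trans (real_ler_norm _) _.
    by rewrite CrealE rmorphD /= conjCK addrC.
  rewrite (le_trans (ler_normD _ _))// norm_conjC mulr_natl mulr2n.
  by rewrite lerD.
rewrite -subr_ge0 => h; rewrite -subr_ge0 opprK.
have -> : J x + (M ^+ 2)%:C = (2 * (M%:C * `|x|) - (f x + (f x)^*)) + (M%:C - `|x|) ^+ 2.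
  by rewrite /J rmorphXn /=; ring.
rewrite addr_ge0// real_exprn_even_ge0// rpredB ?normr_real// complex_real//.
Qed.

(** The quadratic inequality in c comes from J (y + c x) - inf J >= 0, where J y
    is within e^2 of inf J; its linear coefficient is the error
    <x, y> - f x. *)
Lemma approximate_representer (e : R) : 0 < e ->
  exists y, forall x, `|inner x y - f x| <= e%:C * `|x|.
Proof.
move=> e0; pose E := range (fun x => complex.Re (J x)).
have infE : has_inf E.
  split; first by exists (complex.Re (J 0)), 0.
  exists (- M ^+ 2) => _ [x _ <-].
  by rewrite -lecR J_real rmorphN /=.
have [_ [y _ <-] Jy] := inf_adherent (exprn_gt0 2 e0) infE.
exists y => x; rewrite -(@ler_pXn2r _ 2)// ?nnegrE ?mulr_ge0 ?lecR ?(ltW e0)//.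
rewrite exprMn mulrC -[e%:C ^+ 2]rmorphXn.
have Je : J y - (inf E)%:C <= (e ^+ 2)%:C.
  by rewrite -J_real lerBlDl -rmorphD lecR ltW.
apply: le_trans (ler_wpM2l _ Je); last by rewrite exprn_ge0.
apply: quadratic_ge0_discriminant => [|c]; first exact: exprn_ge0.
have Jc : (inf E)%:C <= J (y + c *: x).
  rewrite -J_real lecR; apply: ge_inf; first exact: infE.2.
  by exists (y + c *: x).
have f_yx : f (y + c *: x) = c * f x + f y by rewrite addrC lin_f.
suff -> : `|c| ^+ 2 * `|x| ^+ 2 + (c * (inner x y - f x) + (c * (inner x y - f x))^*)
    + (J y - (inf E)%:C) = J (y + c *: x) - (inf E)%:C by rewrite subr_ge0.
by rewrite /J inner_normD f_yx !(rmorphB, rmorphD, rmorphM) /=; ring.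
Qed.

End Riesz.

(** The approximate representers y_n, with errors 1/(n+1), form a Cauchy
    sequence, because |y_n - y_k|^2 is the difference of the values at
    y_n - y_k of <., y_n> and <., y_k>, both of which are close to f. *)
Theorem riesz (f : H -> C) (M : R) : scalar f ->
  (forall x, `|f x| <= M%:C * `|x|) ->
  exists u, forall x, f x = inner x u.
Proof.
move=> lin_f f_le.
have rpos n : 0 < n.+1%:R^-1 :> R by rewrite invr_gt0.
have [y y_f] := choice (fun n =>
  approximate_representer f M lin_f f_le _ (rpos n)).
have rsmall (e : C) : 0 < e -> exists N, forall n, (N <= n)%N ->
    (n.+1%:R^-1)%:C < e.
  move=> e0.
  have Re_e : 0 < complex.Re e by have := e0; rewrite ltcE /= => /andP[].
  have [N _ NP] := near_infty_natSinv_lt (PosNum Re_e).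
  exists N => n /NP /= h.
  by rewrite -(RRe_real (gtr0_real e0)) ltcR.
have y_close n k : `|y n - y k| <= (n.+1%:R^-1)%:C + (k.+1%:R^-1)%:C.
  have [->|nz] := eqVneq (y n - y k) 0.
    by rewrite normr0 -rmorphD lecR addr_ge0.
  rewrite -(@ler_pM2r _ `|y n - y k|) ?normr_gt0// -expr2.
  have -> : `|y n - y k| ^+ 2 = `|inner (y n - y k) (y n - y k)|.
    by rewrite inner_norm ger0_norm ?exprn_ge0.
  rewrite linearBr /=.
  have -> : inner (y n - y k) (y n) - inner (y n - y k) (y k) =
    inner (y n - y k) (y n) - f (y n - y k) -
      (inner (y n - y k) (y k) - f (y n - y k)) by ring.
  by rewrite (le_trans (ler_normB _ _))// mulrDl lerD ?y_f.
have cvg_y : cvg (y @ \oo)%classic.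
  apply: cauchy_cvg; apply: cauchy_exP => e e0.
  have [N NP] := rsmall (e / 2) (divr_gt0 e0 (ltr0n _ 2)).
  exists (y N); exists N => // n /= Nn.
  rewrite -ball_normE /= (le_lt_trans (y_close _ _))// [ltRHS]splitr.
  by rewrite ltrD// NP.
exists (lim (y @ \oo)%classic) => x; set u := lim _.
have y_u n : `|f x - inner x u| <= ((n.+1%:R^-1)%:C + `|y n - u|) * `|x|.
  have -> : f x - inner x u = inner x (y n - u) - (inner x (y n) - f x).
    by rewrite linearBr /=; ring.
  rewrite (le_trans (ler_normB _ _))// addrC mulrDl lerD//.
  by rewrite mulrC inner_CauchySchwarz.
(* Dividing by |x| + 1 rather than |x| covers x = 0. *)
have x1 : 0 < `|x| + 1 by rewrite ltr_wpDl.
apply/eqP; rewrite -subr_eq0 -normr_eq0; apply/negP => /negP nz.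
have e0 : 0 < `|f x - inner x u| / (`|x| + 1).
  by rewrite divr_gt0// lt0r nz /=.
have [N NP] := rsmall _ (divr_gt0 e0 (ltr0n _ 2)).
have /cvgrPdist_lt /(_ _ (divr_gt0 e0 (ltr0n _ 2))) [K _ KP] := cvg_y.
set e := _ / _ in e0 NP KP.
suff : `|f x - inner x u| < `|f x - inner x u| by rewrite ltxx.
have small : (((maxn N K).+1%:R^-1)%:C + `|y (maxn N K) - u|) <= e.
  rewrite (splitr e) lerD ?ltW//; first exact: NP (leq_maxl _ _).
  by rewrite distrC; exact: KP (leq_maxr _ _).
apply: le_lt_trans (y_u (maxn N K)) _.
apply: le_lt_trans (ler_wpM2r _ small) _ => //.
rewrite -[ltRHS](divfK (lt0r_neq0 x1)) -/e.
by rewrite ltr_pM2l// ltrDl.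
Qed.

(** * Adjoints and positive parts *)

Lemma bounded_operator_comp S S' :
  bounded_operator S -> bounded_operator S' -> bounded_operator (S \o S').
Proof.
move=> [M SM] [N S'N]; exists (`|M| * N) => x /=.
rewrite rmorphM /= -mulrA (le_trans (SM _))//.
apply: le_trans (_ : `|M|%:C * `|S' x| <= _).
  by rewrite ler_wpM2r// lecR ler_norm.
by rewrite ler_wpM2l// lecR.
Qed.

(** The adjoint at y is the vector representing x |-> <Sx, y>; its bound comes
    from |S'y|^2 = <S S'y, y> <= M |S'y| |y|. *)
Lemma bounded_has_adjoint S : bounded_operator S ->
  exists S' : {linear H -> H}, bounded_operator S' /\ is_adjoint S S'.
Proof.
move=> [M SM].
have S_le x : `|S x| <= `|M|%:C * `|x|.
  by rewrite (le_trans (SM x))// ler_wpM2r// lecR ler_norm.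
(* [riesz] asks for a real bound, and the norm of y is real but lives in C. *)
have rep y : exists w, forall x, inner (S x) y = inner x w.
  apply: (riesz (fun x => inner (S x) y) (`|M| * complex.Re `|y|)) => [c u v|x].
    by rewrite linearP inner_linearl.
  rewrite (le_trans (inner_CauchySchwarz _ _))// rmorphM /= RRe_real ?normr_real//.
  by rewrite mulrAC ler_wpM2r.
have [g gP] := choice rep.
have g_lin : linear g.
  move=> c u v; apply: inner_eq => z.
  by rewrite -gP linearDr linearZr_LR /= !gP linearDr linearZr_LR.
pose S' : {linear H -> H} := HB.pack g (GRing.isLinear.Build _ _ _ _ g g_lin).
exists S'; split => [|x y]; last exact: gP.
exists `|M| => y.
(* S' y is only convertible to g y. *)
change (`|g y| <= `|M|%:C * `|y|).
have [->|nz] := eqVneq (g y) 0; first by rewrite normr0 mulr_ge0// lecR.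
rewrite -(@ler_pM2r _ `|g y|) ?normr_gt0// -expr2.
have -> : `|g y| ^+ 2 = `|inner (S (g y)) y|.
  by rewrite gP inner_norm ger0_norm ?exprn_ge0.
rewrite (le_trans (inner_CauchySchwarz _ _))// mulrAC.
by rewrite ler_wpM2r.
Qed.

Lemma adjointP S : bounded_operator S -> is_adjoint S (adjoint S).
Proof. by move=> /bounded_has_adjoint/getPex[]. Qed.

Lemma positive_ReOp S : bounded_operator S -> positive_operator (ReOp S) ->
  forall x, 0 <= inner (S x) x + (inner (S x) x)^*.
Proof.
move=> /adjointP adjS pos x; have := pos x.
rewrite /ReOp /= linearZl_LR linearDl /= [inner (adjoint S x) x]inner_conj -adjS.
by rewrite pmulr_rge0 ?invr_gt0.
Qed.

(** The imaginary part of z is the real part of - 'i * z, so that both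
    positivity hypotheses become statements on the real part of a * inner (S x) x. *)
Lemma positive_ImOp S : bounded_operator S -> positive_operator (ImOp S) ->
  forall x, 0 <= - 'i * inner (S x) x + (- 'i * inner (S x) x)^*.
Proof.
move=> /adjointP adjS pos x; have := pos x.
rewrite /ImOp /= linearZl_LR linearBl /= [inner (adjoint S x) x]inner_conj -adjS.
set z := inner (S x) x.
have -> : - 'i * z + (- 'i * z)^* = 2 * ((2 * 'i)^-1 * (z - z^*)).
  rewrite -!complexiE.
  rewrite rmorphM rmorphN /= !complexiE conjCi opprK.
  rewrite invfM invCi mulrA mulrA divff ?pnatr_eq0// mul1r; ring.
by move=> ?; rewrite mulr_ge0.
Qed.

(** The quadratic function of c obtained at the vectors x + c Sx has no
    quadratic term, as S (x + c Sx) = Sx; its linear coefficient, which is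
    a^* |Sx|^2, must then be zero. *)
Lemma square_zero_positive_real_part S (a : C) : a != 0 ->
  (forall x, S (S x) = 0) ->
  (forall x, 0 <= a * inner (S x) x + (a * inner (S x) x)^*) ->
  forall x, S x = 0.
Proof.
move=> a0 SS pos x.
have : `|a^* * `|S x| ^+ 2| ^+ 2 <= 0 * (a * inner (S x) x + (a * inner (S x) x)^*).
  apply: quadratic_ge0_discriminant => // c.
  have := pos (x + c *: S x).
  have -> : S (x + c *: S x) = S x by rewrite linearD linearZ /= SS scaler0 addr0.
  rewrite linearDr linearZr_LR /= inner_norm => h.
  apply: le_trans h _; rewrite le_eqVlt; apply/orP; left; apply/eqP.
  rewrite !(rmorphD, rmorphM, conjCK) /= !conjCK (geC0_conj (normr_ge0 _)); ring.
rewrite mul0r => h.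
have /eqP : `|a^* * `|S x| ^+ 2| ^+ 2 = 0.
  by apply/eqP; rewrite eq_le h exprn_ge0.
rewrite expf_eq0 /= normr_eq0 mulf_eq0 conjC_eq0 (negPf a0) expf_eq0 /= normr_eq0.
by move/eqP.
Qed.

End InnerProduct.

Theorem theorem4p1 (R : realType) (H : hilbertType R) (dimH : dim_ge H 3)
    (T : {linear H -> H}) (bT : bounded_operator T)
    (T3 : T \o T \o T =1 \0) :
  positive_operator (ReOp (T \o T)) \/ positive_operator (ImOp (T \o T)) ->
  T \o T =1 \0.
Proof.
have bTT : bounded_operator (T \o T) by exact: bounded_operator_comp.
have TTTT x : (T \o T) ((T \o T) x) = 0 by rewrite /= [T (T (T x))]T3 linear0.
case=> [/(positive_ReOp _ bTT) pos|/(positive_ImOp _ bTT) pos].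
  apply: (square_zero_positive_real_part (T \o T) 1) => // x.
  by rewrite mul1r.
apply: (square_zero_positive_real_part (T \o T) (- 'i)) => //.
by rewrite oppr_eq0 neq0Ci.
Qed.
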